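(* Let $L=\{E\}$ be the language of (finite, undirected, loopless) graphs. The following properties are all regular: $\phi_{\rm none}(x)$: ''$x$ is an isolated node'', i.e. $(\forall y)\neg(xEy)$; $\phi_{\rm all}(x)$: ''$x$ is adjacent to every other node'', i.e. $(\forall y)(y\neq x\rightarrow xEy)$; and, for every $k\geq 1$, $\phi_k(x)$: ''$x$ is adjacent to exactly $k$ nodes''.
   Context: $L$-structures are graphs $G=\langle A,E\rangle$ with $E$ a symmetric irreflexive binary relation on $A$; $\mathbf{S}_n(L)$ is the set of all such graphs with node set $\{1,\ldots,n\}$, so $|\mathbf{S}_n(L)|=2^{\binom{n}{2}}$. For a first-order formula $\phi(x)$ of $L$ with one free variable and a graph $G$ with node set $A$, $\phi(G)=\{a\in A:G\models\phi(a)\}$. Let $\mathbf{S}_{2n}(\phi:\mathrm{ntr})=\{G\in\mathbf{S}_{2n}(L):|\phi(G)|=n\}$, $d_{2n}(\phi:\mathrm{ntr})=|\mathbf{S}_{2n}(\phi:\mathrm{ntr})|/|\mathbf{S}_{2n}(L)|$, and $d(\phi:\mathrm{ntr})=\lim_{n\to\infty}d_{2n}(\phi:\mathrm{ntr})$ whenever this limit exists. The property $\phi(x)$ is regular if $d(\phi:\mathrm{ntr})=0$. *)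

(* Defs.v *)
From mathcomp Require Import all_boot all_order all_algebra.
From mathcomp Require Import all_classical all_reals all_analysis.

Set Implicit Arguments.
Unset Strict Implicit.
Unset Printing Implicit Defensive.

Import Order.TTheory GRing.Theory Num.Theory.
Import numFieldNormedType.Exports.
Local Open Scope classical_set_scope.
Local Open Scope ring_scope.

(* First-order formulas of L = {E} with equality. The free variables of a
   formula m are among v_0, ..., v_(m-1), and a quantifier binds the new
   variable v_m (de Bruijn levels), so outer variables keep their index. *)
Inductive formula : nat -> Type :=
| FBot m : formula m
| FEq m (i j : 'I_m) : formula m
| FAdj m (i j : 'I_m) : formula m
| FNot m (f : formula m) : formula m
| FAnd m (f g : formula m) : formula m
| FOr m (f g : formula m) : formula m
| FImp m (f g : formula m) : formula m
| FAll m (f : formula m.+1) : formula m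
| FEx m (f : formula m.+1) : formula m.

Arguments FBot {m}.

Definition extend (T : Type) m (v : 'I_m -> T) (a : T) (i : 'I_m.+1) : T :=
  if unlift ord_max i is Some j then v j else a.

Fixpoint sat (T : finType) (e : rel T) m (f : formula m) : ('I_m -> T) -> bool :=
  match f with
  | FBot _ => fun=> false
  | FEq _ i j => fun v => v i == v j
  | FAdj _ i j => fun v => e (v i) (v j)
  | FNot _ g => fun v => ~~ sat e g v
  | FAnd _ g h => fun v => sat e g v && sat e h v
  | FOr _ g h => fun v => sat e g v || sat e h v
  | FImp _ g h => fun v => sat e g v ==> sat e h v
  | FAll _ g => fun v => [forall a, sat e g (extend v a)]
  | FEx _ g => fun v => [exists a, sat e g (extend v a)]
  end.

Definition realization (T : finType) (e : rel T) (phi : formula 1) : {set T} :=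
  [set a | sat e phi (fun=> a)]%SET.

(* A graph on m labelled nodes is given by its edge relation, as a set of
   ordered pairs; the nodes are numbered from 0. *)
Definition adj m (G : {set 'I_m * 'I_m}) : rel 'I_m := fun x y => (x, y) \in G.

Definition graphs m : {set {set 'I_m * 'I_m}} :=
  [set G : {set 'I_m * 'I_m} |
    [forall x, forall y, adj G x y == adj G y x] &&
    [forall x, ~~ adj G x x]]%SET.

Definition graphs_ntr (phi : formula 1) n : {set {set 'I_(2 * n) * 'I_(2 * n)}} :=
  [set G in graphs (2 * n)%N | #|realization (adj G) phi| == n]%SET.

Definition density_ntr (R : realType) (phi : formula 1) (n : nat) : R :=
  #|graphs_ntr phi n|%:R / #|graphs (2 * n)%N|%:R.

Definition regular (R : realType) (phi : formula 1) : Prop :=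
  density_ntr R phi n @[n --> \oo] --> (0 : R).

Definition phi_none : formula 1 := FAll (FNot (FAdj ord0 ord_max)).

Definition phi_all : formula 1 :=
  FAll (FImp (FNot (FEq ord_max ord0)) (FAdj ord0 ord_max)).

Fixpoint FExs k : formula k.+1 -> formula 1 :=
  match k with
  | 0 => fun f => f
  | k'.+1 => fun f => FExs (FEx f)
  end.

(* exists y_1 ... y_k, /\_(i < j) y_i <> y_j  /\  /\_i x E y_i
                       /\ forall z, x E z -> \/_i z = y_i
   where x = v_0, y_(i+1) = lift ord0 i = v_(i+1), and z = v_(k+1). *)
Definition phi_exactly (k : nat) : formula 1 :=
  let y (i : 'I_k) : 'I_k.+1 := lift ord0 i in
  FExs (FAnd
    (\big[@FAnd k.+1/FNot FBot]_(p : 'I_k * 'I_k | (p.1 < p.2)%N)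
        FNot (FEq (y p.1) (y p.2)))
    (FAnd
      (\big[@FAnd k.+1/FNot FBot]_(i < k) FAdj ord0 (y i))
      (FAll (FImp (FAdj ord0 ord_max)
        (\big[@FOr k.+2/FBot]_(i < k) FEq ord_max (lift ord_max (y i))))))).

(* Main.v *)
(* A uniform graph on m nodes has a uniform neighbourhood at each node v, so a
   prescribed neighbourhood has probability 2 / 2^m. If a property of v only
   allows at most m^k neighbourhoods, the expected number of nodes having it
   is at most 2 m^(k+1) / 2^m, and by Markov's inequality the probability that
   half of the nodes have it tends to 0. Each of the three properties is of
   this kind, with k = 0 for the first two. *)
Require Import Defs.
From mathcomp Require Import all_boot all_order all_algebra.
From mathcomp Require Import all_classical all_reals all_analysis.
From mathcomp Require Import zify.

Set Implicit Arguments.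
Unset Strict Implicit.
Unset Printing Implicit Defensive.

Import Order.TTheory GRing.Theory Num.Theory.
Import numFieldNormedType.Exports.

Section Semantics.
Variables (T : finType) (e : rel T).

Lemma extend_max m (v : 'I_m -> T) a : extend v a ord_max = a.
Proof. by rewrite /extend unlift_none. Qed.

Lemma extend_lift m (v : 'I_m -> T) a i : extend v a (lift ord_max i) = v i.
Proof. by rewrite /extend liftK. Qed.

Lemma extend0 m (v : 'I_m.+1 -> T) a : extend v a ord0 = v ord0.
Proof.
(* As at least one variable is already present, [ord0] is [lift ord_max ord0], an old variable. *)
by rewrite -(extend_lift v a ord0); congr extend; apply: val_inj.
Qed.

Lemma sat_FExs k (f : formula k.+1) v :
  sat e (FExs f) v -> exists2 w, w ord0 = v ord0 & sat e f w.
Proof.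
elim: k f => [|k IHk] f /=; first by move=> fv; exists v.
move=> /IHk[w w0 /existsP[a fa]]; exists (extend w a) => //.
by rewrite extend0.
Qed.

Lemma sat_bigFOr m (I : Type) (r : seq I) (F : I -> formula m) v :
  sat e (\big[@FOr m/FBot]_(i <- r) F i) v -> exists i, sat e (F i) v.
Proof.
by elim/big_rec: _ => //= i f _ IHf /orP[Fi|/IHf //]; exists i.
Qed.

Lemma sat_bigFAnd m (I : eqType) (r : seq I) (F : I -> formula m) v :
  sat e (\big[@FAnd m/FNot FBot]_(i <- r) F i) v ->
  {in r, forall i, sat e (F i) v}.
Proof.
elim: r => // j r IHr; rewrite big_cons /= => /andP[Fj /IHr Fr] i.
by rewrite inE => /predU1P[->|/Fr].
Qed.

End Semantics.

Section Neighbourhoods.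
Variable m : nat.
Implicit Types (G : {set 'I_m * 'I_m}) (v : 'I_m) (S T : {set 'I_m}).

Definition nbhd G v : {set 'I_m} := [set x | adj G v x]%SET.

(** Surgery at [v]: row and column [v] of the adjacency matrix are overwritten by [T], the rest is
    kept. The diagonal entry at [v] becomes [v \in T], so looplessness survives when
    [v \notin T]. *)
Definition with_nbhd v T G : {set 'I_m * 'I_m} :=
  [set p | if p.1 == v then p.2 \in T
           else if p.2 == v then p.1 \in T else p \in G]%SET.

Definition nbhd_fiber v S : {set {set 'I_m * 'I_m}} :=
  [set G in graphs m | nbhd G v == S]%SET.

Lemma adj_sym G : G \in graphs m -> symmetric (adj G).
Proof. by rewrite inE => /andP[/forallP s _] x y; apply/eqP/(forallP (s x)). Qed.

Lemma adj_irr G : G \in graphs m -> irreflexive (adj G).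
Proof. by rewrite inE => /andP[_ /forallP i] x; apply/negbTE. Qed.

Lemma nbhd_sub G v : G \in graphs m -> nbhd G v \in powerset (~: [set v])%SET.
Proof.
move=> gG; rewrite powersetE; apply/fintype.subsetP => x; rewrite !inE => vx.
by apply: contraTneq vx => ->; rewrite adj_irr.
Qed.

Lemma with_nbhd_graph v T G :
  v \notin T -> G \in graphs m -> with_nbhd v T G \in graphs m.
Proof.
move=> vT gG; rewrite inE /adj; apply/andP; split; apply/forallP => x.
  apply/forallP => y; rewrite !inE /=.
  case: (eqVneq x v) => [->|_]; first by case: (eqVneq y v) => [->|].
  by case: (y == v) => //; apply/eqP/(adj_sym gG).
rewrite !inE /=; case: (eqVneq x v) => [->//|_].
by rewrite [_ \in G](adj_irr gG).
Qed.

Lemma nbhd_with_nbhd v T G : nbhd (with_nbhd v T G) v = T.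
Proof. by apply/setP => x; rewrite inE /adj inE /= eqxx. Qed.

(** Only pairs through [v] are altered, and in a symmetric [G] these are all recorded by [S]. *)
Lemma with_nbhdK v S T :
  {in nbhd_fiber v S, cancel (with_nbhd v T) (with_nbhd v S)}.
Proof.
move=> G; rewrite inE => /andP[gG /eqP <-]; apply/setP => -[x y].
rewrite !inE /=; case: (eqVneq x v) => [->//|_].
by case: (eqVneq y v) => [->|//]; rewrite (adj_sym gG).
Qed.

Lemma leq_card_fiber v S T :
  v \notin T -> #|nbhd_fiber v S| <= #|nbhd_fiber v T|.
Proof.
move=> vT; rewrite -(card_in_imset (can_in_inj (@with_nbhdK v S T))).
apply/subset_leq_card/fintype.subsetP => _ /imsetP[G /setIdP[gG _] ->].
by rewrite inE with_nbhd_graph //= nbhd_with_nbhd.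
Qed.

(** The graphs split into the fibers of the [2 ^ m.-1] sets avoiding [v], and by surgery each of
    these fibers is at least as large as that of [S]. *)
Lemma card_nbhd_fiber v S : #|nbhd_fiber v S| * 2 ^ m <= 2 * #|graphs m|.
Proof.
have -> : 2 ^ m = 2 * #|powerset (~: [set v])%SET|.
  rewrite card_powerset cardsC1 card_ord -expnS prednK //.
  exact: leq_ltn_trans (ltn_ord v).
rewrite mulnCA leq_mul2l /= mulnC -sum_nat_const -[leqRHS]sum1_card.
rewrite (partition_big (nbhd^~ v) (mem (powerset (~: [set v])%SET))) /=; last first.
  by move=> G gG; apply: nbhd_sub.
apply: leq_sum => T; rewrite powersetE finset.subsetC finset.sub1set inE => vT.
apply: leq_trans (leq_card_fiber S vT) _.
rewrite -sum1_card; under eq_bigl do rewrite inE; exact: leqnn.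
Qed.

(** First moment by double counting: the pairs of a graph and a node are regrouped by node and
    neighbourhood, which leaves at most [m * b] fibers. *)
Lemma sum_card_nbhd_in (A : 'I_m -> {set {set 'I_m}}) b :
    (forall v, #|A v| <= b) ->
  (\sum_(G in graphs m) #|[set v | nbhd G v \in A v]%SET|) * 2 ^ m
    <= m * b * (2 * #|graphs m|).
Proof.
move=> Ab.
have -> : \sum_(G in graphs m) #|[set v | nbhd G v \in A v]%SET| =
          \sum_v \sum_(S in A v) #|nbhd_fiber v S|.
  under eq_bigr do rewrite -sum1_card big_mkcond /=.
  rewrite exchange_big /=; apply: eq_bigr => v _.
  under [RHS]eq_bigr do rewrite -sum1_card.
  rewrite -big_mkcondr (partition_big (nbhd^~ v) (mem (A v))) /=; last first.
    by move=> G; rewrite !inE => /andP[].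
  apply: eq_bigr => S AS; apply: eq_bigl => G; rewrite !inE -!andbA.
  by do 2!congr (_ && _); case: eqP => [->|]; rewrite ?AS ?andbF.
rewrite -[X in X * b](card_ord m) -mulnA -sum_nat_const big_distrl /=.
apply: leq_sum => v _; rewrite big_distrl /=.
apply: leq_trans (leq_mul (Ab v) (leqnn _)); rewrite -sum_nat_const.
by apply: leq_sum => S _; apply: card_nbhd_fiber.
Qed.

End Neighbourhoods.

(** Raise [n <= q * (n %/ q).+1 <= q * 2 ^ (n %/ q)] to the power [q]. *)
Lemma expn_leq_exp2 q n : 0 < q -> n ^ q <= q ^ q * 2 ^ n.
Proof.
move=> q0; apply: (@leq_trans ((q * 2 ^ (n %/ q)) ^ q)).
  rewrite leq_exp2r // (leq_trans (ltnW (ltn_ceil n q0))) // mulnC leq_mul2l.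
  by rewrite ltn_expl ?orbT.
by rewrite expnMn leq_mul2l -expnM leq_exp2l // leq_divM orbT.
Qed.

Lemma card_graphs_gt0 m : 0 < #|graphs m|.
Proof.
apply/card_gt0P; exists finset.set0; rewrite inE /adj.
by apply/andP; split; apply/forallP => x; [apply/forallP => y|]; rewrite !inE.
Qed.

(** Markov's inequality in counting form. The first moment is only bounded by a constant, which
    already makes the density [O(1/n)]. *)
Lemma card_graphs_ntr phi k n (A : 'I_(2 * n) -> {set {set 'I_(2 * n)}}) :
    (forall v, #|A v| <= (2 * n) ^ k) ->
    (forall v G, G \in graphs (2 * n) -> sat (adj G) phi (fun=> v) ->
      nbhd G v \in A v) ->
  n * #|graphs_ntr phi n| <= 2 * k.+1 ^ k.+1 * #|graphs (2 * n)|.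
Proof.
move=> Ak phiA; set m := (2 * n)%N in A Ak phiA *.
pose s := \sum_(G in graphs m) #|[set v | nbhd G v \in A v]%SET|.
apply: (@leq_trans s).
  rewrite mulnC -sum_nat_const big_mkcond /s [leqRHS]big_mkcond.
  apply: leq_sum => G _; case: ifP => [/setIdP[gG /eqP <-]|//].
  rewrite gG; apply/subset_leq_card/fintype.subsetP => v.
  by rewrite !inE; apply: phiA.
rewrite -(@leq_pmul2r (2 ^ m)) ?expn_gt0 //.
apply: leq_trans (sum_card_nbhd_in Ak) _; rewrite -expnS.
have := expn_leq_exp2 m (ltn0Sn k); rewrite -(leq_pmul2r (m := 2 * #|graphs m|)).
  by move=> /leq_trans -> //; lia.
by rewrite muln_gt0 card_graphs_gt0.
Qed.

Lemma regular_of_nbhds (R : realType) phi k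
    (A : forall m, 'I_m -> {set {set 'I_m}}) :
    (forall m (v : 'I_m), #|A m v| <= m ^ k) ->
    (forall m (v : 'I_m) G, G \in graphs m -> sat (adj G) phi (fun=> v) ->
      nbhd G v \in A m v) ->
  regular R phi.
Proof.
(* After the shift the bound [c / n.+1] is [c * harmonic n], and the division by zero at index 0 is
   avoided. *)
move=> Ak phiA; rewrite /regular -cvg_shiftS.
have bound :
    (((2 * k.+1 ^ k.+1)%:R * harmonic n : R)%R @[n --> \oo] --> 0%R)%classic.
  rewrite -[0%R](mulr0 (2 * k.+1 ^ k.+1)%:R%R).
  by apply: cvgMl_tmp; apply: cvg_harmonic.
apply: (squeeze_cvgr _ (cvg_cst 0%R) bound); near=> n.
rewrite /density_ntr divr_ge0 //= ler_pdivrMr ?ltr0n ?card_graphs_gt0 //.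
rewrite mulrAC ler_pdivlMr ?ltr0n // -!natrM ler_nat mulnC.
exact: card_graphs_ntr (@Ak _) (@phiA _).
Unshelve. all: by end_near. Qed.

Theorem corollary6p3 (R : realType) :
  [/\ regular R phi_none,
      regular R phi_all
    & forall k : nat, (1 <= k)%N -> regular R (phi_exactly k)].
Proof.
split=> [||k _].
- apply: (@regular_of_nbhds _ _ 0 (fun=> fun=> [set finset.set0]%SET)).
    by move=> m v; rewrite cards1.
  move=> m v G _ /forallP none; rewrite inE; apply/eqP/setP => x.
  by move: (none x); rewrite !inE /= extend0 extend_max => /negbTE.
- apply: (@regular_of_nbhds _ _ 0 (fun m v => [set ~: [set v]]%SET)).
    by move=> m v; rewrite cards1.
  move=> m v G gG /forallP all; rewrite inE; apply/eqP/setP => x.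
  move: (all x); rewrite !inE /= extend0 extend_max.
  by case: eqVneq => [->|_ /= -> //]; rewrite adj_irr.
(* A neighbourhood listed by [k] witnesses is the image of a map from ['I_k], and there are [m ^ k]
   such maps. *)
- pose A m : {set {set 'I_m}} :=
    [set [set f i | i : 'I_k] | f : {ffun 'I_k -> 'I_m}]%SET.
  apply: (@regular_of_nbhds _ _ k (fun m _ => A m)) => m v.
    apply: leq_trans (leq_imset_card _ _) _.
    by rewrite card_ffun !card_ord.
  move=> G gG /sat_FExs[w /= w0 /and3P[_ /sat_bigFAnd adjw /forallP onlyw]].
  apply/imsetP; exists [ffun i => w (lift ord0 i)] => //.
  (* The universal clause puts every neighbour among the witnesses; the adjacency clauses give the
     converse. *)
  apply/setP => x; rewrite inE; apply/idP/imsetP => [vx|[i _ ->]].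
    move: (onlyw x); rewrite /= extend0 extend_max w0 vx /= => /sat_bigFOr[i /=].
    by rewrite extend_max extend_lift => /eqP ->; exists i; rewrite ?ffunE.
  by rewrite ffunE -w0; apply: (adjw i); rewrite mem_index_enum.
Qed.
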